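(* Let $(L,\omega)$ be a finite-dimensional quadratic Lie algebra over an algebraically closed field $F$ of characteristic $0$, let $r=\sum_i a_i\otimes b_i\in L\otimes L$, let $R:L\to L$ be the linear operator $R(a)=\sum_i\omega(b_i,a)a_i$, let $R^*$ be the adjoint of $R$ with respect to $\omega$, and let $\lambda\in F$ be nonzero. 1. Suppose that $r$ is a solution of the classical Yang–Baxter equation such that $r+\tau(r)$ is $L$-invariant. Then $R$ and $R^*$ are both Rota–Baxter operators of the same nonzero weight $\lambda$ if and only if $L$ is a direct sum $L=I_1\oplus I_2$ of two ideals such that $$R(a)+R^*(a)+\lambda a\in Z(L)\quad\text{for all } a\in I_1,$$ and $$R([x,y])=R^*([x,y])=0\quad\text{for all } x\in I_2,\ y\in L.$$ 2. Conversely, suppose that $R$ is a Rota–Baxter operator of nonzero weight $\lambda$ such that $R([a,b])+R^*([a,b])=[R(a),b]+[R^*(a),b]$ for all $a,b\in L$. If $L=I_1\oplus I_2$ is a direct sum of two ideals such that $R(a)+R^*(a)+\lambda a\in Z(L)$ for all $a\in I_1$ and $R([x,y])=R^*([x,y])=0$ for all $x\in I_2$, $y\in L$, then $r$ is a solution of the classical Yang–Baxter equation and $r+\tau(r)$ is $L$-invariant.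
   Context: A quadratic Lie algebra $(L,\omega)$ is a Lie algebra $L$ with a non-degenerate symmetric bilinear form $\omega$ that is invariant: $\omega([a,b],c)=\omega(a,[b,c])$ for all $a,b,c\in L$. The adjoint $R^*$ of $R$ is defined by $\omega(R(x),y)=\omega(x,R^*(y))$ for all $x,y\in L$. $Z(L)$ is the center of $L$. An element $r=\sum_i a_i\otimes b_i\in L\otimes L$ is a solution of the classical Yang–Baxter equation (CYBE) if $$\sum_{i,j}\big([a_i,a_j]\otimes b_i\otimes b_j-a_i\otimes[a_j,b_i]\otimes b_j+a_i\otimes a_j\otimes[b_i,b_j]\big)=0 .$$ $\tau$ is the switch map, $\tau(\sum_i a_i\otimes b_i)=\sum_i b_i\otimes a_i$. An element $s=\sum_i c_i\otimes d_i\in L\otimes L$ is $L$-invariant if $[s,y]:=\sum_i([c_i,y]\otimes d_i+c_i\otimes[d_i,y])=0$ for all $y\in L$. A linear map $R:L\to L$ is a Rota–Baxter operator of weight $\lambda\in F$ if $[R(x),R(y)]=R([R(x),y]+[x,R(y)]+\lambda[x,y])$ for all $x,y\in L$. *)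

(* Defs.v *)
From HB Require Import structures.
From mathcomp Require Import all_boot all_algebra.

Set Implicit Arguments.
Unset Strict Implicit.
Unset Printing Implicit Defensive.
Import GRing.Theory VectorInternalTheory.
Local Open Scope ring_scope.

HB.mixin Record Vector_isLie (F : fieldType) L of Vector F L := {
  lieb : L -> L -> L;
  lieb_bilinear : bilinear_for *:%R *:%R lieb;
  liebxx : forall x, lieb x x = 0;
  lieb_jacobi : forall x y z,
    lieb x (lieb y z) + lieb y (lieb z x) + lieb z (lieb x y) = 0
}.

#[short(type="lieAlgType")]
HB.structure Definition LieAlgebra (F : fieldType) :=
  { L of Vector F L & Vector_isLie F L }.

Notation "[[ x , y ]]" := (lieb x y)
  (at level 0, x at level 99, y at level 99, format "[[ x ,  y ]]") : ring_scope.

HB.instance Definition _ (F : fieldType) (L : lieAlgType F) :=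
  bilinear_isBilinear.Build F L L L *:%R *:%R (@lieb F L) lieb_bilinear.

Lemma liebPl (F : fieldType) (L : lieAlgType F) k (x y z : L) :
  [[k *: x + y, z]] = k *: [[x, z]] + [[y, z]].
Proof. exact: lieb_bilinear.1. Qed.

Lemma liebPr (F : fieldType) (L : lieAlgType F) k (x y z : L) :
  [[z, k *: x + y]] = k *: [[z, x]] + [[z, y]].
Proof. exact: lieb_bilinear.2. Qed.

(* U (x) V is realised as matrices of coordinates: if (e_i) and (f_j) are the
   reference bases of U and V, then M stands for \sum_(i, j) M i j *: e_i (x) f_j.
   The lemmas tliftE and tlift_uniq below are the universal property. *)
Definition tensor (F : fieldType) (U V : vectType F) : Type :=
  'M[F]_(dim U, dim V).
HB.instance Definition _ (F : fieldType) (U V : vectType F) :=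
  Vector.on (tensor U V).

Definition tens (F : fieldType) (U V : vectType F) (u : U) (v : V) :
    tensor U V :=
  (v2r u)^T *m v2r v.

Notation "u \ox v" := (tens u v)
  (at level 40, left associativity) : ring_scope.

Definition tlift (F : fieldType) (U V : vectType F) (W : lmodType F)
    (f : U -> V -> W) (t : tensor U V) : W :=
  \sum_(i < dim U) \sum_(j < dim V)
     t i j *: f (r2v (delta_mx 0 i)) (r2v (delta_mx 0 j)).

Section TensorTheory.
Variables (F : fieldType) (U V : vectType F).

Lemma tens_is_bilinear : bilinear_for *:%R *:%R (@tens F U V).
Proof.
split=> [v|u] a x y; rewrite /tens.
  by rewrite linearP /= linearP /= mulmxDl -scalemxAl.
by rewrite linearP /= mulmxDr -scalemxAr.
Qed.

HB.instance Definition _ :=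
  bilinear_isBilinear.Build F U V (tensor U V) *:%R *:%R (@tens F U V)
    tens_is_bilinear.

Lemma tensPl k (u u' : U) (v : V) :
  (k *: u + u') \ox v = k *: (u \ox v) + u' \ox v.
Proof. exact: tens_is_bilinear.1. Qed.

Lemma tensPr k (u : U) (v v' : V) :
  u \ox (k *: v + v') = k *: (u \ox v) + u \ox v'.
Proof. exact: tens_is_bilinear.2. Qed.

Lemma tlift_is_linear (W : lmodType F) (f : U -> V -> W) : linear (tlift f).
Proof.
move=> a s t; rewrite /tlift scaler_sumr -big_split; apply: eq_bigr => i _ /=.
rewrite scaler_sumr -big_split; apply: eq_bigr => j _ /=.
by rewrite !mxE scalerDl scalerA.
Qed.

HB.instance Definition _ (W : lmodType F) (f : U -> V -> W) :=
  GRing.isLinear.Build F (tensor U V) W *:%R (tlift f) (tlift_is_linear f).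

Lemma tliftE (W : lmodType F) (f : U -> V -> W) :
  bilinear_for *:%R *:%R f -> forall u v, tlift f (u \ox v) = f u v.
Proof.
move=> fbil u v.
pose fM := bilinear_isBilinear.Build F U V W *:%R *:%R f fbil.
pose g : {bilinear U -> V -> W} := HB.pack f fM.
have coordE (X : vectType F) (x : X) :
    x = \sum_i v2r x 0 i *: r2v (delta_mx 0 i).
  rewrite -{1}[x]v2rK {1}[v2r x]row_sum_delta linear_sum.
  by apply: eq_bigr => i _; rewrite linearZ.
rewrite -[f]/(g : U -> V -> W) [in RHS](coordE _ u) linear_sumlz.
apply: eq_bigr => i _; rewrite linearZl_LR [in RHS](coordE _ v) linear_sumr.
rewrite scaler_sumr; apply: eq_bigr => j _.
by rewrite linearZr_LR scalerA /tens !mxE big_ord1 !mxE.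
Qed.

Lemma tens_span (t : tensor U V) :
  t = \sum_(i < dim U) \sum_(j < dim V)
        (t i j *: r2v (delta_mx 0 i)) \ox r2v (delta_mx 0 j).
Proof.
rewrite {1}[t]matrix_sum_delta; apply: eq_bigr => i _.
apply: eq_bigr => j _; rewrite linearZl_LR /= /tens !r2vK.
by rewrite trmx_delta mul_delta_mx.
Qed.

Lemma tlift_uniq (W : lmodType F) (f : U -> V -> W)
    (g : {linear tensor U V -> W}) :
  (forall u v, g (u \ox v) = f u v) -> g =1 tlift f.
Proof.
move=> gE t; rewrite {1}(tens_span t) linear_sum; apply: eq_bigr => i _.
rewrite linear_sum; apply: eq_bigr => j _.
by rewrite linearZl_LR linearZ /= gE.
Qed.

End TensorTheory.

Definition tswitch (F : fieldType) (U V : vectType F) :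
    tensor U V -> tensor V U :=
  tlift (fun u v => v \ox u).

Section LieTensor.
Variables (F : fieldType) (L : lieAlgType F).

Definition tact (s : tensor L L) (y : L) : tensor L L :=
  tlift (fun c d => [[c, y]] \ox d + c \ox [[d, y]]) s.

Definition L_invariant (s : tensor L L) : Prop := forall y : L, tact s y = 0.

(* The left-hand side of the CYBE is bilinear in the two copies of r, hence the
   nested lifting; triple tensors are read as (L (x) L) (x) L. *)
Definition cybe_lhs (r : tensor L L) : tensor (tensor L L) L :=
  tlift (fun a b => tlift (fun a' b' =>
      [[a, a']] \ox b \ox b' - a \ox [[a', b]] \ox b' + a \ox a' \ox [[b, b']])
    r) r.

Definition cybe_solution (r : tensor L L) : Prop := cybe_lhs r = 0.

End LieTensor.

Section TensorSums.
Variables (F : fieldType).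

Lemma tswitch_sum (U V : vectType F) n (a : 'I_n -> U) (b : 'I_n -> V) :
  tswitch (\sum_i a i \ox b i) = \sum_i b i \ox a i.
Proof.
rewrite /tswitch linear_sum; apply: eq_bigr => i _ /=; rewrite tliftE //.
by split=> [v|u] k x y; rewrite /= ?tensPl ?tensPr.
Qed.

Variable L : lieAlgType F.

Lemma tact_sum n (c d : 'I_n -> L) y :
  tact (\sum_i c i \ox d i) y
    = \sum_i ([[c i, y]] \ox d i + c i \ox [[d i, y]]).
Proof.
rewrite /tact linear_sum; apply: eq_bigr => i _ /=; rewrite tliftE //.
split=> [v|u] k x z; rewrite /= !(liebPl, liebPr, tensPl, tensPr);
  by rewrite scalerDr addrACA.
Qed.

Lemma cybe_lhs_sum n (a b : 'I_n -> L) :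
  cybe_lhs (\sum_i a i \ox b i)
    = \sum_i \sum_j ([[a i, a j]] \ox b i \ox b j
                     - a i \ox [[a j, b i]] \ox b j
                     + a i \ox a j \ox [[b i, b j]]).
Proof.
have E (p q s p' q' s' : tensor (tensor L L) L) (k : F) :
  (k *: p + p') - (k *: q + q') + (k *: s + s')
    = k *: (p - q + s) + (p' - q' + s').
  rewrite scalerDr scalerBr opprD [in LHS](addrACA (k *: p)).
  by rewrite [in LHS](addrACA (k *: p - k *: q)).
pose f (x y : L) (x' y' : L) :=
  [[x, x']] \ox y \ox y' - x \ox [[x', y]] \ox y' + x \ox x' \ox [[y, y']].
have lin_in x y : bilinear_for *:%R *:%R (f x y).
  by split=> [v|u] k s t; rewrite /f /= !(liebPl, liebPr, tensPl, tensPr) E.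
have in_sum x y :
    tlift (f x y) (\sum_i a i \ox b i) = \sum_j f x y (a j) (b j).
  by rewrite linear_sum; apply: eq_bigr => j _ /=; rewrite (tliftE (lin_in _ _)).
rewrite /cybe_lhs linear_sum; apply: eq_bigr => i _ /=.
rewrite tliftE; first exact: in_sum.
split=> [v|u] k s t; rewrite -!/(f _ _) /= !in_sum scaler_sumr -big_split;
  by apply: eq_bigr => j _; rewrite /f /= !(liebPl, liebPr, tensPl, tensPr) E.
Qed.

End TensorSums.

Section LieDefs.
Variables (F : fieldType) (L : lieAlgType F).

Definition invariant_form (omega : L -> L -> F) : Prop :=
  forall a b c : L, omega [[a, b]] c = omega a [[b, c]].

Definition is_adjoint (omega : L -> L -> F) (R Rs : L -> L) : Prop :=
  forall x y : L, omega (R x) y = omega x (Rs y).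

Definition in_center (z : L) : Prop := forall x : L, [[z, x]] = 0.

Definition is_ideal (I : {vspace L}) : Prop :=
  forall x y : L, x \in I -> [[x, y]] \in I.

Definition rota_baxter (lambda : F) (R : L -> L) : Prop :=
  forall x y : L,
    [[R x, R y]] = R ([[R x, y]] + [[x, R y]] + lambda *: [[x, y]]).

Definition ideal_direct_sum (I1 I2 : {vspace L}) : Prop :=
  [/\ is_ideal I1, is_ideal I2, (I1 + I2 = fullv)%VS & directv (I1 + I2)].

End LieDefs.

(* Main.v *)
(* Contracting the tensor slots with omega (which is injective, by
   nondegeneracy) turns the CYBE into [Rx, Ry] = R([x, Ry] - [R^*x, y]) and the
   invariance of r + tau(r) into "S = R + R^* commutes with the adjoint action";
   taking adjoints, the CYBE also holds with R and R^* exchanged.  Put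
   T = S + lambda.  Given both conditions, R is Rota-Baxter of weight lambda iff
   R T vanishes on [L, L], and likewise for R^*.  In that case the Fitting
   decomposition of T gives the two ideals: I1 is the kernel and I2 the image of
   a high power of T. *)
Require Import Defs.
From HB Require Import structures.
From mathcomp Require Import all_boot all_algebra.
Set Implicit Arguments.
Unset Strict Implicit.
Unset Printing Implicit Defensive.
Import GRing.Theory VectorInternalTheory.
Local Open Scope ring_scope.

(** * Fitting decomposition *)

(** Square until the rank stops dropping. If [g] and its square have the same rank, rank-nullity for
    [g] on its image gives [lker g :&: limg g = 0]. The predicate [P] carries whatever is needed
    along the squarings, so no exponent appears. *)
Lemma fitting_ind (F : fieldType) (V : vectType F) (P : 'End(V) -> Prop)
    (f : 'End(V)) :
  P f -> (forall g, P g -> P (g \o g)%VF) ->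
  exists g : 'End(V),
    [/\ P g, (lker g + limg g = fullv)%VS & directv (lker g + limg g)].
Proof.
move=> Pf Psq.
have [g Pg le_g] : exists2 g, P g & (\dim (limg g) <= \dim (limg (g \o g)))%N.
  have [d] := ubnP (\dim (limg f)); elim: d => // d IHd in f Pf * => lt_f_d.
  have [le_f | lt_f] := leqP (\dim (limg f)) (\dim (limg (f \o f))).
    by exists f.
  by apply: (IHd (f \o f)%VF (Psq _ Pf)); apply: leq_trans lt_f _.
have capg : (lker g :&: limg g = 0)%VS.
  apply/eqP; rewrite -dimv_eq0 -leqn0 capvC.
  rewrite -(leq_add2r (\dim (limg (g \o g)))) add0n [in leqLHS]limg_comp.
  by rewrite limg_ker_dim.
exists g; split=> //; last exact/directv_addP.
apply/eqP; rewrite eqEdim subvf dimv_disjoint_sum //.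
by rewrite -(limg_ker_dim g fullv) capfv leqnn.
Qed.

(** * Contracting the last tensor factor *)

Section Contraction.
Variables (F : fieldType) (U V : vectType F).

(** The map [id \ox phi]. On [(L \ox L) \ox L], two successive contractions leave the first
    factor. *)
Definition tcontract (phi : {scalar V}) : tensor U V -> U :=
  tlift (fun u v => phi v *: u).

Lemma tcontract_is_linear (phi : {scalar V}) : linear (tcontract phi).
Proof. exact: tlift_is_linear. Qed.

HB.instance Definition _ phi :=
  GRing.isLinear.Build F (tensor U V) U *:%R (tcontract phi)
    (tcontract_is_linear phi).

Lemma tcontractE (phi : {scalar V}) u v : tcontract phi (u \ox v) = phi v *: u.
Proof.
rewrite /tcontract tliftE //; split=> [w|w] k x y /=.
  by rewrite scalerDr !scalerA mulrC.
by rewrite linearP scalerDl scalerA.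
Qed.

Lemma tcontract0 (phi : {scalar V}) : tcontract phi 0 = 0.
Proof. exact: linear0. Qed.

Lemma tcontractD (phi : {scalar V}) s t :
  tcontract phi (s + t) = tcontract phi s + tcontract phi t.
Proof. exact: linearD. Qed.

Lemma tcontractB (phi : {scalar V}) s t :
  tcontract phi (s - t) = tcontract phi s - tcontract phi t.
Proof. exact: linearB. Qed.

Lemma tcontractZ (phi : {scalar V}) k t :
  tcontract phi (k *: t) = k *: tcontract phi t.
Proof. exact: linearZ. Qed.

Lemma tcontract_sum (phi : {scalar V}) n (t : 'I_n -> tensor U V) :
  tcontract phi (\sum_i t i) = \sum_i tcontract phi (t i).
Proof. exact: linear_sum. Qed.

(** Row [i] of [t] holds the coordinates of the vector [v_i] in [t = \sum_i e_i \ox v_i]. The [i]-th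
    coordinate of a contraction is [phi v_i], so a separating family forces every [v_i] to
    vanish. *)
Lemma tcontract_sep (I : Type) (phi : I -> {scalar V}) :
    (forall v, (forall i, phi i v = 0) -> v = 0) ->
  forall t : tensor U V, (forall i, tcontract (phi i) t = 0) -> t = 0.
Proof.
move=> phi_sep t t0; apply/row_matrixP => i; rewrite row0.
apply: (can_inj r2vK); rewrite linear0; apply: phi_sep => k.
have := congr1 (fun u => v2r u 0 i) (t0 k).
rewrite /tcontract /tlift !linear0 mxE => <-.
rewrite linear_sum summxE (bigD1 i) //= [X in _ + X]big1 ?addr0 => [|j ji].
  rewrite linear_sum summxE [row i t]row_sum_delta !linear_sum.
  apply: eq_bigr => j _.
  by rewrite !linearZ /= r2vK !mxE !eqxx mulr1.
rewrite linear_sum summxE big1 // => l _.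
by rewrite !linearZ /= r2vK !mxE (eq_sym i) (negPf ji) andbF !mulr0.
Qed.

End Contraction.

(** * Elementary bracket rules *)

Section LieBracket.
Variables (F : fieldType) (L : lieAlgType F).
Implicit Types x y z : L.

Lemma liebDl x y z : [[x + y, z]] = [[x, z]] + [[y, z]].
Proof. exact: (linearDl (@lieb F L)). Qed.

Lemma liebDr x y z : [[z, x + y]] = [[z, x]] + [[z, y]].
Proof. exact: (linearDr (@lieb F L)). Qed.

Lemma liebZl k x y : [[k *: x, y]] = k *: [[x, y]].
Proof. exact: (linearZl_LR (@lieb F L)). Qed.

Lemma lieb0l y : [[0, y]] = 0 :> L.
Proof. exact: (linear0l (@lieb F L)). Qed.

Lemma lieb_suml n (c : 'I_n -> L) y : [[\sum_i c i, y]] = \sum_i [[c i, y]].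
Proof. exact: (linear_sumlz (@lieb F L)). Qed.

Lemma lieb_sumr n (c : 'I_n -> L) y : [[y, \sum_i c i]] = \sum_i [[y, c i]].
Proof. exact: (linear_sumr (@lieb F L)). Qed.

Lemma liebZr k x y : [[y, k *: x]] = k *: [[y, x]].
Proof. exact: (linearZr_LR (@lieb F L)). Qed.

Lemma liebC x y : [[x, y]] = - [[y, x]].
Proof.
apply/eqP; rewrite -addr_eq0; apply/eqP.
by have := liebxx (x + y); rewrite liebDl !liebDr !liebxx add0r addr0.
Qed.

End LieBracket.

(** * Operator forms of the CYBE and of invariance *)

Section QuadraticLie.
Variables (F : fieldType) (L : lieAlgType F) (omega : {symmetric L}).
Hypothesis omega_nondeg : nondegenerate omega.
Hypothesis omega_inv : invariant_form omega.
Implicit Types x y z : L.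

Lemma formC x y : omega x y = omega y x.
Proof. by rewrite hermC expr0 mul1r. Qed.

Lemma formBr x y z : omega z (x - y) = omega z x - omega z y.
Proof. exact: linearBr. Qed.

Lemma formNr x z : omega z (- x) = - omega z x.
Proof. exact: linearNr. Qed.

Lemma formZr k x z : omega z (k *: x) = k * omega z x.
Proof. exact: linearZr_LR. Qed.

Lemma form_sumr n (c : 'I_n -> L) z :
  omega z (\sum_i c i) = \sum_i omega z (c i).
Proof. exact: linear_sumr. Qed.

Lemma form_sep x : (forall y, omega x y = 0) -> x = 0.
Proof.
move=> x0; apply/eqP; rewrite -memv0 -(eqP omega_nondeg).
by apply/mem_orthovP => y _.
Qed.

Lemma form_inj x y : (forall z, omega z x = omega z y) -> x = y.
Proof.
move=> xy; apply/eqP; rewrite -subr_eq0; apply/eqP/form_sep => z.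
by rewrite formC linearBr /= xy subrr.
Qed.

Definition omegar y : {scalar L} := applyr omega y.

Lemma tcontract_form_sep (U : vectType F) (t : tensor U L) :
  (forall y, tcontract (omegar y) t = 0) -> t = 0.
Proof. by apply: tcontract_sep => v; apply: form_sep. Qed.

(** This is the operator of [\sum_i a i \ox b i]; exchanging [a] and [b] gives that of the switched
    tensor, which is the adjoint. *)
Definition form_op n (a b : 'I_n -> L) x : L := \sum_i omega (b i) x *: a i.

Section Contractions.
Variables (n : nat) (a b : 'I_n -> L).
Let r : tensor L L := \sum_i a i \ox b i.

Lemma tcontract_tact x y :
  tcontract (omegar x) (tact r y)
    = [[form_op a b x, y]] - form_op a b [[x, y]].
Proof.
rewrite tact_sum linear_sum lieb_suml -sumrB; apply: eq_bigr => i _.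
rewrite linearD /= !tcontractE /= liebZl omega_inv (liebC y).
by rewrite linearNr scaleNr.
Qed.

(** The third slot is paired with [y], the second with [x]. With [R], [Rs] the operators of [a b]
    and [b a], the three CYBE terms become [[[R x, R y]]], [- R [[x, R y]]] and [R [[Rs x, y]]];
    invariance moves brackets across the form in the last two. *)
Lemma tcontract_cybe x y :
  tcontract (omegar x) (tcontract (omegar y) (cybe_lhs r))
    = [[form_op a b x, form_op a b y]]
      - form_op a b ([[x, form_op a b y]] - [[form_op b a x, y]]).
Proof.
have opB u v : form_op a b (u - v) = form_op a b u - form_op a b v.
  by rewrite -sumrB; apply: eq_bigr => i _; rewrite formBr scalerBl.
(* Each operator term becomes a double sum shaped like the contracted tensor, for a termwise
   comparison. *)
have bracketE : [[form_op a b x, form_op a b y]] =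
    \sum_i \sum_j omega (b j) y *: (omega (b i) x *: [[a i, a j]]).
  rewrite lieb_suml; apply: eq_bigr => i _; rewrite lieb_sumr.
  by apply: eq_bigr => j _; rewrite liebZl liebZr !scalerA mulrC.
have rightE : form_op a b [[x, form_op a b y]] =
    \sum_i \sum_j omega (b j) y *: (omega [[x, a j]] (b i) *: a i).
  apply: eq_bigr => i _; rewrite lieb_sumr form_sumr scaler_suml.
  by apply: eq_bigr => j _; rewrite liebZr formZr scalerA (formC (b i)).
have leftE : form_op a b [[form_op b a x, y]] =
    \sum_i \sum_j omega (b i) [[b j, y]] *: (omega (a j) x *: a i).
  apply: eq_bigr => i _; rewrite lieb_suml form_sumr scaler_suml.
  by apply: eq_bigr => j _; rewrite liebZl formZr scalerA mulrC.
rewrite opB bracketE rightE leftE opprB addrA cybe_lhs_sum.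
rewrite (tcontract_sum (omegar y)) tcontract_sum.
rewrite -big_split -sumrB; apply: eq_bigr => i _ /=.
rewrite (tcontract_sum (omegar y)) tcontract_sum.
rewrite -big_split -sumrB; apply: eq_bigr => j _ /=.
rewrite tcontractD tcontractB !tcontractE tcontractD tcontractB !tcontractZ.
rewrite !tcontractE /= (omega_inv (b i)).
by rewrite (formC [[a j, b i]]) -(omega_inv x) addrAC.
Qed.

Lemma cybe_solutionP :
  cybe_solution r <->
  forall x y, [[form_op a b x, form_op a b y]]
    = form_op a b ([[x, form_op a b y]] - [[form_op b a x, y]]).
Proof.
split=> [r0 x y | opE].
  apply/eqP; rewrite -subr_eq0 -tcontract_cybe r0.
  by rewrite !tcontract0.
apply: tcontract_form_sep => y; apply: tcontract_form_sep => x.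
by rewrite tcontract_cybe opE subrr.
Qed.

End Contractions.

Lemma L_invariantP n (a b : 'I_n -> L) (r := \sum_i a i \ox b i : tensor L L) :
  L_invariant (r + tswitch r) <->
  forall x y, form_op a b [[x, y]] + form_op b a [[x, y]]
    = [[form_op a b x, y]] + [[form_op b a x, y]].
Proof.
have tactE x y : tcontract (omegar x) (tact (r + tswitch r) y) =
    [[form_op a b x, y]] + [[form_op b a x, y]]
      - (form_op a b [[x, y]] + form_op b a [[x, y]]).
  rewrite /tact linearD -!/(tact _ _) tcontractD.
  by rewrite tswitch_sum !tcontract_tact addrACA opprD.
split=> [r0 x y | opE y].
  by apply/esym/eqP; rewrite -subr_eq0 -tactE r0 tcontract0.
by apply: tcontract_form_sep => x; rewrite tactE opE subrr.
Qed.

Lemma adjoint_form_op n (a b : 'I_n -> L) (R Rs : L -> L) :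
  R =1 form_op a b -> is_adjoint omega R Rs -> Rs =1 form_op b a.
Proof.
move=> RE adjR x; apply: form_inj => y.
rewrite -adjR RE formC !form_sumr; apply: eq_bigr => i _.
by rewrite !formZr (formC x) (formC y) mulrC.
Qed.

(** Pair with [z] and move [Rs] and the brackets across the form: the hypothesis at [x], [z], paired
    with [y], gives the claim once the two terms containing [[[R z, x]]] and [[[x, R z]]] cancel. *)
Lemma op_cybe_adjoint (R Rs : L -> L) :
    is_adjoint omega R Rs ->
    (forall x y, [[R x, R y]] = R ([[x, R y]] - [[Rs x, y]])) ->
  forall x y, [[Rs x, Rs y]] = Rs ([[x, Rs y]] - [[R x, y]]).
Proof.
move=> adjR opE x y; apply: form_inj => z.
rewrite -adjR formBr -!(omega_inv (R z)) (liebC (R z) (R x)) opE.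
rewrite (formC (- _)) formNr opprK (formC y) adjR (formC (_ - _)) formBr.
rewrite (formC [[R z, x]]) (liebC (R z)) formNr addKr.
by rewrite -formNr -liebC [RHS]formC omega_inv.
Qed.

End QuadraticLie.

(** * The Rota-Baxter identity against the operator CYBE *)

Section RotaBaxter.
Variables (F : fieldType) (L : lieAlgType F) (R Rs : 'End(L)) (lambda : F).
Let T : 'End(L) := (R + Rs + lambda *: \1)%VF.
Hypothesis opI : forall x y : L,
  R [[x, y]] + Rs [[x, y]] = [[R x, y]] + [[Rs x, y]].

Lemma shiftE x : T x = R x + Rs x + lambda *: x.
Proof. by rewrite !add_lfunE scale_lfunE id_lfunE. Qed.

Lemma shift_lieb x y : T [[x, y]] = [[T x, y]].
Proof. by rewrite !shiftE opI !liebDl liebZl. Qed.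

(** By [opI], [[[R x, y]]] is [R [[x, y]] + Rs [[x, y]] - [[Rs x, y]]], and [lambda *: [[x, y]]]
    completes the first two terms to [T [[x, y]]]. *)
Lemma rota_baxter_arg x y :
  [[R x, y]] + [[x, R y]] + lambda *: [[x, y]]
    = [[x, R y]] - [[Rs x, y]] + T [[x, y]].
Proof.
rewrite shiftE opI !addrA (addrAC [[x, R y]]) subrK.
by rewrite [in RHS](addrC [[x, R y]]).
Qed.

Lemma rota_baxter_shift :
    (forall x y, [[R x, R y]] = R ([[x, R y]] - [[Rs x, y]])) ->
  rota_baxter lambda R <-> (forall x y, R (T [[x, y]]) = 0).
Proof.
move=> opE; split=> [rbR x y | RT x y]; last first.
  by rewrite rota_baxter_arg linearD /= RT addr0 opE.
have /eqP := rbR x y; rewrite rota_baxter_arg linearD opE -subr_eq0 opprD.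
by rewrite addNKr oppr_eq0 => /eqP.
Qed.

End RotaBaxter.

(** * Passing between [T] and the two ideals *)

Section Decomposition.
Variables (F : fieldType) (L : lieAlgType F) (R Rs : 'End(L)) (lambda : F).
Let T : 'End(L) := (R + Rs + lambda *: \1)%VF.
Hypothesis opI : forall x y : L,
  R [[x, y]] + Rs [[x, y]] = [[R x, y]] + [[Rs x, y]].

(* On [L, L] the operator T satisfies T^2 = lambda T, so the powers of T used
   in the Fitting decomposition are nonzero multiples of T there. *)
Lemma ideal_decomposition :
    lambda != 0 ->
    (forall x y, R (T [[x, y]]) = 0) -> (forall x y, Rs (T [[x, y]]) = 0) ->
  exists I1 I2 : {vspace L},
    [/\ ideal_direct_sum I1 I2,
        forall x : L, x \in I1 -> in_center (R x + Rs x + lambda *: x)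
      & forall x y : L, x \in I2 -> R [[x, y]] = 0 /\ Rs [[x, y]] = 0].
Proof.
move=> lambda_neq0 RT RsT.
have TT x y : T (T [[x, y]]) = lambda *: T [[x, y]].
  by rewrite [LHS]shiftE RT RsT !add0r.
(* The first clause makes kernel and image ideals, the next two give the condition on the image, and
   the last one centrality on the kernel. *)
pose P (g : 'End(L)) := [/\ forall x y, g [[x, y]] = [[g x, y]],
  forall x y, R [[g x, y]] = 0, forall x y, Rs [[g x, y]] = 0
  & exists2 mu, mu != 0 & forall x y, g [[x, y]] = mu *: T [[x, y]]].
have PT : P T.
  split=> [x y|x y|x y|]; rewrite -?shift_lieb //.
  by exists 1; [exact: oner_neq0 | move=> x y; rewrite scale1r].
have PM g : P g -> P (g \o g)%VF.
  case=> gad Rg Rsg [mu mu_neq0 gT].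
  split=> [x y|x y|x y|]; rewrite ?comp_lfunE //.
    by rewrite !gad.
  (* On brackets, the square of [mu *: T] is [mu ^+ 2 *: (T \o T)], and [TT] supplies the factor
     [lambda]. *)
  exists (mu * (mu * lambda)); first by rewrite !mulf_neq0.
  move=> x y.
  by rewrite comp_lfunE gad gT -gad gT linearZ /= TT !scalerA !mulrA.
have [g [ [gad Rg Rsg [mu mu_neq0 gT] ] sum_g dir_g] ] := fitting_ind PT PM.
exists (lker g), (limg g); split.
- split=> // x y; first by rewrite !memv_ker gad => /eqP->; rewrite lieb0l.
  by case/memv_imgP=> u _ ->; rewrite -gad memv_img ?memvf.
(* For [g x = 0], [mu *: [[T x, y]] = g [[x, y]] = [[g x, y]] = 0], and [mu] is nonzero. *)
- move=> x; rewrite memv_ker => /eqP gx0 y.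
  have := gT x y; rewrite gad gx0 lieb0l shift_lieb // shiftE => /esym/eqP.
  by rewrite scaler_eq0 (negPf mu_neq0) => /eqP.
- by move=> _ y /memv_imgP[u _ ->].
Qed.

(** Write [x = u + v] along the ideals. Then [T [[u, y]] = [[T u, y]] = 0] since [T u] is central,
    while [T] acts as [lambda] on [[[v, y]]], which [R] and [Rs] kill. *)
Lemma decomposition_shift (I1 I2 : {vspace L}) :
    ideal_direct_sum I1 I2 ->
    (forall x : L, x \in I1 -> in_center (R x + Rs x + lambda *: x)) ->
    (forall x y : L, x \in I2 -> R [[x, y]] = 0 /\ Rs [[x, y]] = 0) ->
  forall x y, R (T [[x, y]]) = 0 /\ Rs (T [[x, y]]) = 0.
Proof.
case=> _ _ sumI _ I1c I2c x y.
have /memv_addP[u Iu [v Iv ->] ] : x \in (I1 + I2)%VS by rewrite sumI memvf.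
have [Rv Rsv] := I2c v y Iv.
have -> : T [[u + v, y]] = lambda *: [[v, y]].
  rewrite liebDl linearD /= shift_lieb // shiftE I1c // add0r.
  by rewrite [LHS]shiftE Rv Rsv !add0r.
by rewrite !linearZ /= Rv Rsv scaler0.
Qed.

End Decomposition.

Theorem theorem4 (F : closedFieldType) (charF : [pchar F] =i pred0)
  (L : lieAlgType F) (omega : {symmetric L})
  (omega_nondeg : nondegenerate omega) (omega_inv : invariant_form omega)
  (n : nat) (a b : 'I_n -> L)
  (r : tensor L L) (r_def : r = \sum_(i < n) a i \ox b i)
  (R : 'End(L)) (R_def : forall x : L, R x = \sum_(i < n) omega (b i) x *: a i)
  (Rs : 'End(L)) (Rs_adj : is_adjoint omega R Rs)
  (lambda : F) (lambda_neq0 : lambda != 0) :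
  (cybe_solution r -> L_invariant (r + tswitch r) ->
     (rota_baxter lambda R /\ rota_baxter lambda Rs
      <->
      exists I1 I2 : {vspace L},
        [/\ ideal_direct_sum I1 I2,
            forall x : L, x \in I1 -> in_center (R x + Rs x + lambda *: x)
          & forall x y : L, x \in I2 -> R [[x, y]] = 0 /\ Rs [[x, y]] = 0]))
  /\
  (rota_baxter lambda R ->
   (forall x y : L, R [[x, y]] + Rs [[x, y]] = [[R x, y]] + [[Rs x, y]]) ->
   forall I1 I2 : {vspace L},
     ideal_direct_sum I1 I2 ->
     (forall x : L, x \in I1 -> in_center (R x + Rs x + lambda *: x)) ->
     (forall x y : L, x \in I2 -> R [[x, y]] = 0 /\ Rs [[x, y]] = 0) ->
     cybe_solution r /\ L_invariant (r + tswitch r)).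
Proof.
have RE : R =1 form_op omega a b by [].
have RsE : Rs =1 form_op omega b a by apply: adjoint_form_op RE Rs_adj.
have cybeP : cybe_solution r <->
    forall x y, [[R x, R y]] = R ([[x, R y]] - [[Rs x, y]]).
  rewrite r_def.
  split=> [/(cybe_solutionP omega_nondeg omega_inv) opE x y | opE].
    by rewrite !RE RsE opE.
  by apply/(cybe_solutionP omega_nondeg omega_inv) => x y; rewrite -!RE -RsE.
have invP : L_invariant (r + tswitch r) <->
    forall x y, R [[x, y]] + Rs [[x, y]] = [[R x, y]] + [[Rs x, y]].
  rewrite r_def.
  split=> [/(L_invariantP omega_nondeg omega_inv) opE x y | opE].
    by rewrite !RE !RsE opE.
  by apply/(L_invariantP omega_nondeg omega_inv) => x y; rewrite -!RE -!RsE.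
split=> [/cybeP opE /invP opI | rbR opI I1 I2 sumI I1c I2c].
  (* The hypotheses are symmetric in [R] and [Rs], so the criterion for [R] also applies to [Rs],
     with the same [T] up to [addrC]. *)
  have opIs x y : Rs [[x, y]] + R [[x, y]] = [[Rs x, y]] + [[R x, y]].
    by rewrite addrC opI addrC.
  have opEs := op_cybe_adjoint omega_nondeg omega_inv Rs_adj opE.
  have rbP := rota_baxter_shift lambda opI opE.
  have rbsP := rota_baxter_shift lambda opIs opEs; rewrite (addrC Rs) in rbsP.
  split=> [ [/rbP RT /rbsP RsT] | [I1 [I2 [sumI I1c I2c] ] ] ].
    exact: ideal_decomposition.
  have RT := decomposition_shift opI sumI I1c I2c.
  by split; [apply/rbP | apply/rbsP] => x y; have [] := RT x y.
(* Conversely, [R (T [[x, y]]) = 0] removes the [T] term from the Rota-Baxter identity, leaving the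
   operator CYBE. *)
have RT := decomposition_shift opI sumI I1c I2c.
split; last exact/invP.
apply/cybeP => x y; rewrite rbR (rota_baxter_arg lambda opI) linearD /=.
by have [-> _] := RT x y; rewrite addr0.
Qed.
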